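(* Let $\alpha\in\Pi$ and $m,n\ge0$. The following relations hold when applied to any element of any object $M$ of $\mathcal X$: $$E_{\alpha,m}E_{\alpha,n}={m+n\brack m}E_{\alpha,m+n},\qquad F_{\alpha,m}F_{\alpha,n}={m+n\brack m}F_{\alpha,m+n}.$$ In particular: (1) The operators $E_{\alpha,m}$ and $E_{\alpha,n}$ commute for all $m,n\ge0$, and the operators $F_{\alpha,m}$ and $F_{\alpha,n}$ commute for all $m,n\ge0$. (2) $[1][2]\cdots[n]\,E_{\alpha,n}=E_{\alpha,1}^n$ and $[1][2]\cdots[n]\,F_{\alpha,n}=F_{\alpha,1}^n$ for all $n\ge0$.
   Context: $R$ is a simply laced root system (i.e. $\langle\alpha,\beta^\vee\rangle\in\{0,-1\}$ for $\alpha\ne\beta$ in the basis) with basis $\Pi$ and weight lattice $X$; $\alpha^\vee$ is the coroot of $\alpha$. Partial order on $X$: $\mu\le\lambda$ iff $\lambda-\mu$ is a (possibly empty) sum of elements of $\Pi$. A subset $T\subset X$ is quasi-bounded (from above) if for all $\mu\in X$ the set $\{\lambda\in T\mid\mu\le\lambda\}$ is finite. $K$ is a field and $q\in K^\times$ is an arbitrary invertible element. Quantum numbers: in $\mathbb Z[v,v^{-1}]$ set $[n]=\frac{v^n-v^{-n}}{v-v^{-1}}$ for $n\in\mathbb Z$, and for $a,b\in\mathbb Z$ let ${a\brack b}=\frac{[a][a-1]\cdots[a-b+1]}{[1][2]\cdots[b]}\in\mathbb Z[v,v^{-1}]$ if $b>0$, ${a\brack 0}=1$, and ${a\brack b}=0$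 if $b<0$. These are regarded as elements of $K$ via $v\mapsto q$. The category $\mathcal X=\mathcal X_{(K,q)}$: objects are $X$-graded $K$-vector spaces $M=\bigoplus_{\mu\in X}M_\mu$ with $K$-linear operators $E_{\alpha,n}=E_{\mu,\alpha,n}\colon M_\mu\to M_{\mu+n\alpha}$ and $F_{\alpha,n}=F_{\mu,\alpha,n}\colon M_{\mu+n\alpha}\to M_\mu$ for all $\mu\in X$, $\alpha\in\Pi$, $n>0$ (with $E_{\mu,\alpha,0}=F_{\mu,\alpha,0}=\operatorname{id}_{M_\mu}$ and $E_{\mu,\alpha,n}=F_{\mu,\alpha,n}=0$ for $n<0$), such that: (X1) The set of $\mu$ with $M_\mu\ne0$ is quasi-bounded from above and each $M_\mu$ is finite dimensional. (X2) For all $\mu\in X$, $\alpha,\beta\in\Pi$, $m,n>0$ and $v\in M_{\mu+n\beta}$: $E_{\alpha,m}F_{\beta,n}(v)=F_{\beta,n}E_{\alpha,m}(v)$ if $\alpha\ne\beta$, and $E_{\alpha,m}F_{\alpha,n}(v)=\sum_{r\in\mathbb Z}{\langle\mu,\alpha^\vee\rangle+m+n\brack r}F_{\alpha,n-r}E_{\alpha,m-r}(v)$ if $\alpha=\beta$. (X3) For all $\mu\in X$: $M_\mu=\ker E_\mu\oplus\operatorname{im}F_\mu$, where $M_{\delta\mu}:=\bigoplus_{\alpha\in\Pi,n>0}M_{\mu+n\alpha}$, $E_\mu\colon M_\mu\to M_{\delta\mu}$ has components $E_{\mu,\alpha,n}$, and $F_\mu\colon M_{\delta\mu}\to M_\mu$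 is $(v_{\mu+n\alpha})\mapsto\sum_{\alpha,n}F_{\mu,\alpha,n}(v_{\mu+n\alpha})$. Morphisms are grading-preserving $K$-linear maps commuting with all $E$- and $F$-operators. *)

(* Defs.v *)
From HB Require Import structures.
From mathcomp Require Import all_boot all_order all_algebra archimedean.
From mathcomp Require Import boolp classical_sets cardinality.

Set Implicit Arguments.
Unset Strict Implicit.
Unset Printing Implicit Defensive.

Import Order.TTheory GRing.Theory Num.Theory.
Local Open Scope ring_scope.

(** * Quantum numbers *)

(* Z[v,v^-1] is viewed inside its fraction field Q(v) = {fraction {poly int}},
   where the defining quotients of quantum numbers can be formed literally. *)
Definition qv : {fraction {poly int}} := tofrac 'X.

Definition qint (n : int) : {fraction {poly int}} :=
  (qv ^ n - qv ^ (- n)) / (qv - qv^-1).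

Definition qfact (n : nat) : {fraction {poly int}} :=
  \prod_(1 <= i < n.+1) qint i%:Z.

Definition qbin (a b : int) : {fraction {poly int}} :=
  match b with
  | Posz n => (\prod_(0 <= i < n) qint (a - i%:Z)) / qfact n
  | Negz _ => 0
  end.

Local Open Scope classical_set_scope.

Definition laurent_repr (x : {fraction {poly int}}) : set ({poly int} * nat) :=
  [set pk | x = tofrac pk.1 / qv ^+ pk.2].

(* The image in K of a Laurent polynomial x under v |-> q.  Any way of writing
   x as p(v) / v^k gives the same value, see qspecE; elements of Q(v) that are
   not Laurent polynomials are sent to 0. *)
Definition qspec (K : fieldType) (q : K) (x : {fraction {poly int}}) : K :=
  let pk := xget (0, 0%N) (laurent_repr x) in
  (map_poly intr pk.1).[q] / q ^+ pk.2.

Lemma qspecE (K : fieldType) (q : K) (p : {poly int}) (k : nat) :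
  q != 0 -> qspec q (tofrac p / qv ^+ k) = (map_poly intr p).[q] / q ^+ k.
Proof.
move=> q0; rewrite /qspec; set x := tofrac p / qv ^+ k.
have [] := xgetPex (0, 0%N) (ex_intro (laurent_repr x) (p, k) erefl).
case: (xget _ _) => p' k' /= /eqP.
have qvn0 n : qv ^+ n != 0.
  by rewrite expf_neq0 // /qv tofrac_eq0 polyX_eq0.
rewrite /x /= eqr_div ?qvn0 // /qv -!tofracXn -!tofracM tofrac_eq => /eqP e.
apply/eqP; rewrite eqr_div ?expf_neq0 //; apply/eqP.
have := congr1 (fun r => (map_poly intr r : {poly K}).[q]) e.
by rewrite /= !rmorphM /= !map_polyXn !hornerM !hornerXn => ->.
Qed.

(** * Root systems and weights *)

(* Reduced crystallographic root systems in a finite-dimensional space over an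
   archimedean field (such as rat or the reals); [coroot R a b] is <b, a^vee>.
   On a spanning set of roots the coroots are determined by the axioms. *)
Record root_system (F : archiRealFieldType) (V : vectType F) := RootSystem {
  roots : seq V;
  coroot : V -> 'Hom(V, F^o);
  roots_span : <<roots>>%VS = fullv;
  roots_neq0 : 0 \notin roots;
  coroot_root : {in roots, forall a, coroot a a = 2};
  roots_reflect :
    {in roots &, forall a b, b - (coroot a b : F) *: a \in roots};
  roots_integral :
    {in roots &, forall a b, (coroot a b : F) \is a Num.int};
  roots_reduced :
    {in roots, forall a (c : F), c *: a \in roots -> c = 1 \/ c = -1}
}.

Definition is_weight (F : archiRealFieldType) (V : vectType F)
    (R : root_system V) : {pred V} :=
  [pred x | all (fun a => (coroot R a x : F) \is a Num.int) (roots R)].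

Fact is_weight_zmod_closed (F : archiRealFieldType) (V : vectType F)
  (R : root_system V) : zmod_closed (is_weight R).
Proof.
split=> [|x y /allP wx /allP wy]; apply/allP => a aR /=.
  by rewrite linear0 rpred0.
by rewrite linearB rpredB ?wx ?wy.
Qed.

HB.instance Definition _ (F : archiRealFieldType) (V : vectType F)
    (R : root_system V) :=
  GRing.isZmodClosed.Build V (is_weight R) (is_weight_zmod_closed R).

Record weight (F : archiRealFieldType) (V : vectType F) (R : root_system V) :=
  Weight { wval :> V; wvalP : wval \in is_weight R }.

HB.instance Definition _ (F : archiRealFieldType) (V : vectType F)
  (R : root_system V) := [isSub for @wval F V R].
HB.instance Definition _ (F : archiRealFieldType) (V : vectType F)
  (R : root_system V) := [Choice of weight R by <:].
HB.instance Definition _ (F : archiRealFieldType) (V : vectType F)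
  (R : root_system V) := [SubChoice_isSubZmodule of weight R by <:].

(* Listing a basis by weights is no restriction: every root is a weight. *)
Record root_basis (F : archiRealFieldType) (V : vectType F)
    (R : root_system V) := RootBasis {
  simples :> seq (weight R);
  simples_root : {subset map val simples <= roots R};
  simples_basis : basis_of fullv (map val simples);
  simples_sign : {in roots R, forall b, exists c : weight R -> nat,
    b = \sum_(a <- simples) wval a *+ c a \/
    b = - \sum_(a <- simples) wval a *+ c a}
}.

Definition simple (F : archiRealFieldType) (V : vectType F)
  (R : root_system V) (Pi : root_basis R) : Type := seq_sub (simples Pi).

Definition simple_weight (F : archiRealFieldType) (V : vectType F)
  (R : root_system V) (Pi : root_basis R) (a : simple Pi) : weight R :=
  ssval a.
Coercion simple_weight : simple >-> weight.

(* <mu, a^vee>; the value of the coroot is an integer, on which floor is exact. *)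
Definition pairing (F : archiRealFieldType) (V : vectType F)
  (R : root_system V) (Pi : root_basis R) (mu : weight R) (a : simple Pi)
  : int := Num.floor (coroot R (wval a) (wval mu) : F).

Definition simply_laced (F : archiRealFieldType) (V : vectType F)
  (R : root_system V) (Pi : root_basis R) : Prop :=
  forall a b : simple Pi, a != b -> pairing a b = 0 \/ pairing a b = -1.

Definition weight_le (F : archiRealFieldType) (V : vectType F)
  (R : root_system V) (Pi : root_basis R) (mu la : weight R) : Prop :=
  exists s : seq (simple Pi), la - mu = \sum_(a <- s) (a : weight R).

Definition quasi_bounded (F : archiRealFieldType) (V : vectType F)
  (R : root_system V) (Pi : root_basis R) (T : set (weight R)) : Prop :=
  forall mu : weight R, finite_set [set la | T la /\ weight_le Pi mu la].

(** * Graded spaces with E- and F-operators *)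

Definition subspace (K : fieldType) (M : lmodType K) (S : set M) : Prop :=
  S 0 /\ forall (c : K) (u v : M), S u -> S v -> S (c *: u + v).

Definition finite_dim (K : fieldType) (M : lmodType K) (S : set M) : Prop :=
  exists s : seq M, (forall u, u \in s -> S u) /\
    forall v, S v -> exists c : 'I_(size s) -> K, v = \sum_i c i *: s`_i.

(* M is the (internal) direct sum of the subspaces M_mu *)
Definition direct_sum (K : fieldType) (X : eqType) (M : lmodType K)
    (homog : X -> set M) : Prop :=
  (forall v : M, exists (s : seq X) (c : X -> M),
     (forall mu, homog mu (c mu)) /\ v = \sum_(mu <- s) c mu) /\
  (forall (s : seq X) (c : X -> M), uniq s ->
     (forall mu, homog mu (c mu)) -> \sum_(mu <- s) c mu = 0 ->
     forall mu, mu \in s -> c mu = 0).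

(* The operators E_{mu,a,n} (mu in X) are assembled into one endomorphism
   [opE a n] of the whole space, and likewise for F.  Since every weight is of
   the form mu + n a, this also determines F_{a,n} on all of M. *)
Record graded_EF (K : fieldType) (F : archiRealFieldType) (V : vectType F)
    (R : root_system V) (Pi : root_basis R) := GradedEF {
  total :> lmodType K;
  homog : weight R -> set total;
  opE : simple Pi -> int -> {linear total -> total};
  opF : simple Pi -> int -> {linear total -> total};
  homog_subspace : forall mu, subspace (homog mu);
  homog_direct : direct_sum homog;
  opE_homog : forall mu (a : simple Pi) (n : nat) v, (0 < n)%N ->
    homog mu v -> homog (mu + (a : weight R) *+ n) (opE a n%:Z v);
  opF_homog : forall mu (a : simple Pi) (n : nat) v, (0 < n)%N ->
    homog (mu + (a : weight R) *+ n) v -> homog mu (opF a n%:Z v);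
  opE0 : forall a v, opE a 0 v = v;
  opF0 : forall a v, opF a 0 v = v;
  opE_neg : forall a (n : int) v, n < 0 -> opE a n v = 0;
  opF_neg : forall a (n : int) v, n < 0 -> opF a n v = 0
}.

Arguments homog {K F V R Pi _} mu _.
Arguments opE {K F V R Pi _} a n.
Arguments opF {K F V R Pi _} a n.

Definition kerE (K : fieldType) (F : archiRealFieldType) (V : vectType F)
    (R : root_system V) (Pi : root_basis R) (M : graded_EF K Pi)
    (mu : weight R) : set M :=
  [set v : M | homog mu v /\
           forall (a : simple Pi) (n : nat), (0 < n)%N -> opE a n%:Z v = 0].

(* An element of M_{delta mu} is a family (w a n) with finite support,
   recorded here by a bound N. *)
Definition imF (K : fieldType) (F : archiRealFieldType) (V : vectType F)
    (R : root_system V) (Pi : root_basis R) (M : graded_EF K Pi)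
    (mu : weight R) : set M :=
  [set v : M | exists (N : nat) (w : simple Pi -> nat -> M),
     (forall (a : simple Pi) n, homog (mu + (a : weight R) *+ n) (w a n)) /\
     v = \sum_(a : simple Pi) \sum_(1 <= n < N) opF a n%:Z (w a n)].

Definition axX1 (K : fieldType) (F : archiRealFieldType) (V : vectType F)
    (R : root_system V) (Pi : root_basis R) (M : graded_EF K Pi) : Prop :=
  quasi_bounded Pi [set mu | exists v : M, homog mu v /\ v <> 0] /\
  forall mu, finite_dim (homog mu : set M).

(* In the sum over all integers r only the terms with 0 <= r <= min(m,n) can
   be nonzero: the binomial vanishes for r < 0, one of the operators for
   r > min(m,n). *)
Definition axX2 (K : fieldType) (q : K) (F : archiRealFieldType)
    (V : vectType F) (R : root_system V) (Pi : root_basis R)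
    (M : graded_EF K Pi) : Prop :=
  forall (mu : weight R) (a b : simple Pi) (m n : nat) (v : M),
    (0 < m)%N -> (0 < n)%N -> homog (mu + (b : weight R) *+ n) v ->
    (a != b -> opE a m%:Z (opF b n%:Z v) = opF b n%:Z (opE a m%:Z v)) /\
    (a = b -> opE a m%:Z (opF a n%:Z v) =
       \sum_(0 <= r < (minn m n).+1)
         qspec q (qbin (pairing mu a + m%:Z + n%:Z) r%:Z) *:
           opF a (n%:Z - r%:Z) (opE a (m%:Z - r%:Z) v)).

Definition axX3 (K : fieldType) (F : archiRealFieldType) (V : vectType F)
    (R : root_system V) (Pi : root_basis R) (M : graded_EF K Pi) : Prop :=
  forall mu : weight R,
    (forall v : M, homog mu v ->
       exists k f : M, [/\ kerE mu k, imF mu f & v = k + f]) /\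
    (forall v : M, kerE mu v -> imF mu v -> v = 0).

Record objX (K : fieldType) (q : K) (F : archiRealFieldType) (V : vectType F)
    (R : root_system V) (Pi : root_basis R) := ObjX {
  graded_of :> graded_EF K Pi;
  objX1 : axX1 graded_of;
  objX2 : axX2 q graded_of;
  objX3 : axX3 graded_of
}.

(* Main.v *)
Require Import Defs.
From HB Require Import structures.
From mathcomp Require Import all_boot all_order all_algebra archimedean.
From mathcomp Require Import boolp classical_sets cardinality.
From mathcomp Require Import finmap ring zify.

Set Implicit Arguments.
Unset Strict Implicit.
Unset Printing Implicit Defensive.

Import Order.TTheory GRing.Theory Num.Theory.
Local Open Scope ring_scope.

(** An object of the category is determined from the top weights downwards, so
    both families of relations are proved by induction on the weight of the
    vector, starting from above: quasi-boundedness makes the relation of lying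
    strictly above a weight well founded on the weights that occur
    ([quasi_bounded_ind]).

    For the F-operators, put z = F_m F_n v - c F_(m+n) v with c the claimed
    coefficient and m, n > 0.  Visibly z lies in the image of the F-operators.
    By (X3) it vanishes as soon as every E_(b,k) with k > 0 kills it.  If b is
    not a, then E_(b,k) commutes with F and raises the weight of v, so the
    induction applies.  If b = a, commuting E_k to the right produces terms
    F_(m-r) F_(n-s) E_(k-r-s) v.  Each of them either has a vector of higher
    weight or, when r + s = k, products of F-operators of smaller total degree;
    so a second induction on m + n replaces each product by a multiple of
    F_(m+n-t) with t = r + s.  What remains is that the coefficients agree with
    those of c E_k F_(m+n) v.

    For the E-operators, (X3) splits v into a vector killed by all E and a sum
    of vectors F_(b,l) w with w of higher weight.  The relation is trivial on
    the former, and on the latter it is the relation for w moved past F_(b,l).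
    The comparison of coefficients is the same one with m and n exchanged.

    The comparison is a quantum Saalschuetz summation ([bbin_saalschutz]):
    the sum over r + s = t of
      [x; r] [x+m+n-r; s] [m+n-t; m-r]   equals   [x+n; t] [m+n; m].
    Writing D_t(x) for the left-hand side, one has
      [t] D_t(x) = [x+n] D_(t-1)(x-1),
    which only uses the three-term relation
      [i] [y-j] + [j] [y+i] = [i+j] [y].
    The division by [t] is legitimate in Q(v), and the resulting identity of
    Laurent polynomials is then specialised to q, which may be a root
    of unity. *)

(** * Binomials over a field with a three-term relation *)

Section ThreeTerm.

Variables (L : fieldType) (br : int -> L).
Hypothesis br_exchange : forall i j y : int,
  br i * br (y - j) + br j * br (y + i) = br (i + j) * br y.
Hypothesis br_neq0 : forall n : nat, (0 < n)%N -> br n%:Z != 0.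

Definition bfact (n : nat) : L := \prod_(1 <= i < n.+1) br i%:Z.

Definition bbin (x : int) (n : nat) : L :=
  (\prod_(0 <= i < n) br (x - i%:Z)) / bfact n.

(** The structure constants of a divided power algebra: the coefficient of
    X_(i+j) in X_i X_j, where X_i = 0 for i < 0.  Integer arguments let sums
    over r run past the degrees without case distinctions. *)
Definition bmul (i j : int) : L :=
  match i, j with
  | Posz m, Posz n => bfact (m + n) / (bfact m * bfact n)
  | _, _ => 0
  end.

Lemma br0 : br 0 = 0.
Proof.
have /eqP := br_exchange 0 0 1; rewrite subr0 addr0 -subr_eq0 addrK.
by rewrite mulf_eq0 (negPf (br_neq0 (ltnSn 0))) orbF => /eqP.
Qed.

Lemma bfact0 : bfact 0 = 1.
Proof. by rewrite /bfact big_geq. Qed.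

Lemma bfactS (n : nat) : bfact n.+1 = bfact n * br n.+1%:Z.
Proof. by rewrite /bfact big_nat_recr. Qed.

Lemma bfact_neq0 (n : nat) : bfact n != 0.
Proof.
elim: n => [|n IH]; first by rewrite bfact0 oner_eq0.
by rewrite bfactS mulf_neq0 ?br_neq0.
Qed.

Lemma bbin0 (x : int) : bbin x 0 = 1.
Proof. by rewrite /bbin big_geq // bfact0 divr1. Qed.

Lemma bbin_mul_top (x : int) (r : nat) :
  br r.+1%:Z * bbin x r.+1 = br x * bbin (x - 1) r.
Proof.
rewrite /bbin big_nat_recl // subr0 bfactS.
under eq_bigr => i _ do rewrite -addn1 PoszD opprD addrCA addrC.
by field; rewrite bfact_neq0 br_neq0.
Qed.

Lemma bbin_mul_bottom (x : int) (r : nat) :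
  br r.+1%:Z * bbin x r.+1 = br (x - r%:Z) * bbin x r.
Proof.
rewrite /bbin big_nat_recr //= bfactS.
by field; rewrite bfact_neq0 br_neq0.
Qed.

(** The weight [r + s] is distributed over the two factors of a product
    [x; r] [y; s]: the first summand lowers r, and in the second the factor
    [s] remains available for lowering s. *)
Lemma bbin_split (x : int) (r s : nat) :
  br (r + s)%N%:Z * bbin x r =
    (if r is r'.+1 then br (x + s%:Z) * bbin (x - 1) r' else 0)
    + br s%:Z * bbin (x - 1) r.
Proof.
case: r => [|r]; first by rewrite !bbin0 add0n add0r.
apply: (mulfI (@br_neq0 r.+1 isT)).
rewrite mulrDr mulrCA bbin_mul_top [X in _ = _ + X]mulrCA bbin_mul_bottom.
have -> : x - 1 - r%:Z = x - r.+1%:Z by lia.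
have -> : (r.+1 + s)%N%:Z = s%:Z + r.+1%:Z by lia.
by rewrite [LHS]mulrA -br_exchange; ring.
Qed.

Lemma bmulC (i j : int) : bmul i j = bmul j i.
Proof. by case: i j => m [] n //=; rewrite addnC [_ * bfact m]mulrC. Qed.

Lemma bmul0 (n : nat) : bmul 0 n%:Z = 1.
Proof. by rewrite /= bfact0 mul1r divff // bfact_neq0. Qed.

Lemma bmul_rec (m : nat) (j : int) :
  br m.+1%:Z * bmul m.+1%:Z j = br (m.+1%:Z + j) * bmul m%:Z j.
Proof.
case: j => n /=; last by rewrite !mulr0.
rewrite addSn !bfactS -PoszD addSn.
by field; rewrite !bfact_neq0 br_neq0.
Qed.

Lemma bmul_bin (m n : nat) : bmul m%:Z n%:Z = bbin (m%:Z + n%:Z) m.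
Proof.
elim: m => [|m IH]; first by rewrite bbin0 bmul0.
apply: (mulfI (@br_neq0 m.+1 isT)); rewrite bbin_mul_top bmul_rec.
by rewrite (_ : m.+1%:Z + n%:Z - 1 = m%:Z + n%:Z) ?IH //; lia.
Qed.

(** The recursion behind the Saalschuetz sum.  It fails at i = j = 0, where the
    left-hand side is 0; this is what limits that sum to t <= m + n. *)
Lemma bmul_exchange (i j y : int) : ~~ ((i == 0) && (j == 0)) ->
  br (y - j) * bmul (i - 1) j + br (y + i) * bmul i (j - 1) = br y * bmul i j.
Proof.
have predS (n : nat) : n.+1%:Z - 1 = n%:Z by lia.
case: i j => [[|m]|m] [[|n]|n] // _; rewrite ?predS.
- by rewrite !bmul0 mulr0 add0r addr0.
- by rewrite /= !mulr0 addr0.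
- by rewrite !(bmulC _ 0) !bmul0 subr0 mulr0 addr0.
- apply: (mulfI (@br_neq0 (m.+1 + n.+1) isT)).
  have recl := bmul_rec m n.+1%:Z.
  have recr := bmul_rec n m.+1%:Z.
  rewrite ![bmul _ m.+1%:Z]bmulC [_ + m.+1%:Z]addrC in recr.
  transitivity (br (y - n.+1%:Z) * (br (m.+1%:Z + n.+1%:Z) * bmul m%:Z n.+1%:Z)
    + br (y + m.+1%:Z) * (br (m.+1%:Z + n.+1%:Z) * bmul m.+1%:Z n%:Z)).
    by rewrite PoszD; ring.
  by rewrite -recl -recr [RHS]mulrA PoszD -br_exchange; ring.
- by rewrite /= !mulr0 addr0.
- by rewrite /= !mulr0 addr0.
- by rewrite /= !mulr0 addr0.
- by rewrite /= !mulr0 addr0.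
Qed.

(** With D_t(x) for the sum, [t] D_t(x) = [x + n] D_(t-1)(x - 1): [bbin_split]
    turns [t] times each summand into one term with r lowered and one with s
    lowered, and after reindexing the two terms over the same binomials
    combine by [bmul_exchange]. *)
Lemma bbin_saalschutz (m n t : nat) (x : int) : (t <= m + n)%N ->
  \sum_(0 <= r < t.+1)
    bbin x r * bbin (x + m%:Z + n%:Z - r%:Z) (t - r)
      * bmul (m%:Z - r%:Z) (n%:Z - (t - r)%N%:Z)
  = bbin (x + n%:Z) t * bmul m%:Z n%:Z.
Proof.
elim: t x => [|t IH] x ht.
  by rewrite big_nat1 !subr0 !bbin0 !mul1r.
apply: (mulfI (@br_neq0 t.+1 isT)).
rewrite [RHS]mulrA bbin_mul_top -[RHS]mulrA.
have -> : x + n%:Z - 1 = x - 1 + n%:Z by lia.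
rewrite -IH; last by lia.
pose c := x + m%:Z + n%:Z.
pose w (r s : nat) := bmul (m%:Z - r%:Z) (n%:Z - s%:Z).
(* The two parts, indexed by the lowered pair with r + s = t. *)
pose A (r s : nat) :=
  br (x + s%:Z) * bbin (x - 1) r * bbin (c - r.+1%:Z) s * w r.+1 s.
pose B (r s : nat) :=
  bbin (x - 1) r * (br (c - r%:Z) * bbin (c - r%:Z - 1) s) * w r s.+1.
rewrite mulr_sumr.
transitivity (\sum_(0 <= r < t.+2) (if r is r'.+1 then A r' (t - r')%N else 0)
   + \sum_(0 <= r < t.+2) (if (r <= t)%N then B r (t - r)%N else 0)).
  rewrite -big_split; apply: eq_big_nat => r hr.
  have ht1 : t.+1%:Z = (r + (t.+1 - r))%N%:Z by lia.
  transitivity (br t.+1%:Z * bbin x r * bbin (c - r%:Z) (t.+1 - r)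
      * w r (t.+1 - r)%N); first by rewrite /c /w; ring.
  rewrite ht1 bbin_split mulrDl mulrDl /=; congr (_ + _).
    by case: r {hr ht1} => [|r]; rewrite ?mul0r // subSS.
  case: leqP => hr2; last first.
    by rewrite (_ : t.+1 - r = 0)%N ?br0 ?mul0r //; lia.
  by rewrite /B subSn // -bbin_mul_top /w; ring.
rewrite big_nat_recl // add0r [X in _ + X]big_nat_recr //= ltnn addr0 -big_split.
rewrite mulr_sumr; apply: eq_big_nat => r /andP[_]; rewrite ltnS => hr.
rewrite hr /= /A /B /w.
have -> : c - r.+1%:Z = x - 1 + m%:Z + n%:Z - r%:Z by rewrite /c; lia.
have -> : c - r%:Z - 1 = x - 1 + m%:Z + n%:Z - r%:Z by rewrite /c; lia.
have -> : m%:Z - r.+1%:Z = m%:Z - r%:Z - 1 by lia.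
have -> : n%:Z - (t - r).+1%:Z = n%:Z - (t - r)%N%:Z - 1 by lia.
have -> : x + (t - r)%N%:Z = x + n%:Z - (n%:Z - (t - r)%N%:Z) by lia.
have -> : c - r%:Z = x + n%:Z + (m%:Z - r%:Z) by rewrite /c; lia.
rewrite [RHS]mulrCA -bmul_exchange; first by ring.
by apply/andP => -[]; lia.
Qed.

End ThreeTerm.

(** * Quantum numbers *)

Lemma qv_neq0 : qv != 0.
Proof. by rewrite tofrac_eq0 polyX_eq0. Qed.

Lemma qvX_neq1 (n : nat) : (0 < n)%N -> qv ^+ n != 1.
Proof.
move=> n0; rewrite -tofracXn -tofrac1 tofrac_eq.
apply/eqP => /(congr1 (fun p : {poly int} => size p)).
by rewrite size_polyXn size_poly1 => -[] n0'; rewrite n0' in n0.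
Qed.

Lemma qv_sub_neq0 : qv - qv^-1 != 0.
Proof.
rewrite subr_eq0; apply/eqP => e; have /eqP := qvX_neq1 (isT : 0 < 2)%N.
by apply; rewrite expr2 {2}e divff // qv_neq0.
Qed.

Lemma qint_neq0 (n : nat) : (0 < n)%N -> qint n%:Z != 0.
Proof.
move=> n0; apply: mulf_neq0; last by rewrite invr_neq0 ?qv_sub_neq0.
rewrite subr_eq0 -exprnN -exprnP; apply/eqP => e.
have /eqP : qv ^+ (n + n) != 1 by rewrite qvX_neq1 // addn_gt0 n0.
by apply; rewrite exprD {2}e divff // expf_neq0 // qv_neq0.
Qed.

Lemma qvzD (i j : int) : qv ^ (i + j) = qv ^ i * qv ^ j.
Proof. by rewrite expfzDr // qv_neq0. Qed.

Lemma qvz_neq0 (i : int) : qv ^ i != 0.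
Proof. by rewrite expfz_neq0 // qv_neq0. Qed.

(** The three-term relation, with a, b, c in the place of v^i, v^j, v^y. *)
Lemma bracket_exchange (L : fieldType) (a b c d : L) :
  a != 0 -> b != 0 -> c != 0 -> d != 0 ->
  (a - a^-1) / d * ((c * b^-1 - c^-1 * b) / d)
  + (b - b^-1) / d * ((c * a - c^-1 * a^-1) / d)
  = (a * b - a^-1 * b^-1) / d * ((c - c^-1) / d).
Proof. by move=> a0 b0 c0 d0; field; rewrite a0 b0 c0 d0. Qed.

Lemma qint_exchange (i j y : int) :
  qint i * qint (y - j) + qint j * qint (y + i) = qint (i + j) * qint y.
Proof.
rewrite /qint !opprD !qvzD opprK -!invr_expz.
exact: bracket_exchange (qvz_neq0 i) (qvz_neq0 j) (qvz_neq0 y) qv_sub_neq0.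
Qed.

(** The decomposition of [x] into [x - n] and [n], with a, b in the place of
    v^x, v^n. *)
Lemma bracket_add (L : fieldType) (a b d : L) : a != 0 -> b != 0 ->
  (a - a^-1) / d = b * ((a * b^-1 - a^-1 * b) / d) + a^-1 * b * ((b - b^-1) / d).
Proof.
by move=> a0 b0; rewrite !mulrA -mulrDl; congr (_ / _); field; rewrite a0 b0.
Qed.

Lemma qint_add (x n : int) :
  qint x = qv ^ n * qint (x - n) + qv ^ (n - x) * qint n.
Proof.
rewrite /qint opprB !qvzD -!invr_expz [(qv ^ n) / (qv ^ x)]mulrC.
exact: bracket_add (qvz_neq0 x) (qvz_neq0 n).
Qed.

Lemma pascal_of_ratios (L : fieldType) (k a b c d B P Q : L) : k != 0 ->
  k * P = a * B -> k * Q = b * B -> a = c * b + d * k -> P = c * Q + d * B.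
Proof.
by move=> k0 hP hQ ha; apply: (mulfI k0); rewrite hP ha mulrDr mulrCA hQ; ring.
Qed.

Lemma qbin_pascal (x : int) (n : nat) :
  qbin x n.+1%:Z =
  qv ^ n.+1%:Z * qbin (x - 1) n.+1%:Z + qv ^ (n.+1%:Z - x) * qbin (x - 1) n%:Z.
Proof.
have k0 := @qint_neq0 n.+1 isT.
have hP := bbin_mul_top qint_neq0 x n.
have hQ := bbin_mul_bottom qint_neq0 (x - 1) n.
have ha := qint_add x n.+1%:Z.
rewrite (_ : x - 1 - n%:Z = x - n.+1%:Z) in hQ; last by lia.
exact (pascal_of_ratios k0 hP hQ ha).
Qed.

(** * Specialisation of Laurent polynomials *)

Definition laurent (x : {fraction {poly int}}) : Prop :=
  exists (p : {poly int}) (k : nat), x = tofrac p / qv ^+ k.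

Lemma laurent_addE (p p' : {poly int}) (k k' : nat) :
  tofrac p / qv ^+ k + tofrac p' / qv ^+ k' =
  tofrac (p * 'X^k' + p' * 'X^k) / qv ^+ (k + k').
Proof.
rewrite addf_div ?expf_neq0 ?qv_neq0 // exprD.
by rewrite tofracD !tofracM !tofracXn.
Qed.

Lemma laurent_mulE (p p' : {poly int}) (k k' : nat) :
  (tofrac p / qv ^+ k) * (tofrac p' / qv ^+ k') =
  tofrac (p * p') / qv ^+ (k + k').
Proof. by rewrite mulf_div exprD tofracM. Qed.

Lemma laurentD x y : laurent x -> laurent y -> laurent (x + y).
Proof.
move=> [p [k ->]] [p' [k' ->]]; rewrite laurent_addE.
by exists (p * 'X^k' + p' * 'X^k), (k + k')%N.
Qed.

Lemma laurentM x y : laurent x -> laurent y -> laurent (x * y).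
Proof.
move=> [p [k ->]] [p' [k' ->]]; rewrite laurent_mulE.
by exists (p * p'), (k + k')%N.
Qed.

Lemma laurent0 : laurent 0.
Proof. by exists 0, 0%N; rewrite tofrac0 mul0r. Qed.

Lemma laurent1 : laurent 1.
Proof. by exists 1, 0%N; rewrite tofrac1 divr1. Qed.

Lemma laurent_sum (s : seq nat) (f : nat -> {fraction {poly int}}) :
  (forall i, laurent (f i)) -> laurent (\sum_(i <- s) f i).
Proof.
by move=> h; elim/big_rec: _ => [|i x _ hx]; [exact: laurent0 | exact: laurentD].
Qed.

Lemma laurent_qvz (i : int) : laurent (qv ^ i).
Proof.
case: i => n.
  by exists 'X^n, 0%N; rewrite tofracXn divr1.
by exists 1, n.+1; rewrite tofrac1 div1r.
Qed.

Section Specialisation.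

Variables (K : fieldType) (q : K).
Hypothesis q_neq0 : q != 0.

Lemma qspecD x y : laurent x -> laurent y ->
  qspec q (x + y) = qspec q x + qspec q y.
Proof.
move=> [p [k ->]] [p' [k' ->]]; rewrite laurent_addE !qspecE //.
rewrite addf_div ?expf_neq0 // exprD.
by rewrite rmorphD !rmorphM /= !map_polyXn hornerD !hornerM !hornerXn.
Qed.

Lemma qspecM x y : laurent x -> laurent y ->
  qspec q (x * y) = qspec q x * qspec q y.
Proof.
move=> [p [k ->]] [p' [k' ->]]; rewrite laurent_mulE !qspecE //.
by rewrite mulf_div exprD rmorphM /= hornerM.
Qed.

Lemma qspec0 : qspec q 0 = 0.
Proof.
have := qspecE 0 0 q_neq0.
by rewrite tofrac0 mul0r rmorph0 horner0 mul0r.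
Qed.

Lemma qspec1 : qspec q 1 = 1.
Proof.
have := qspecE 1 0 q_neq0.
by rewrite tofrac1 divr1 rmorph1 hornerC divr1.
Qed.

Lemma qspec_sum (s : seq nat) (f : nat -> {fraction {poly int}}) :
  (forall i, laurent (f i)) ->
  qspec q (\sum_(i <- s) f i) = \sum_(i <- s) qspec q (f i).
Proof.
move=> h; elim: s => [|i s IH]; first by rewrite !big_nil qspec0.
by rewrite !big_cons qspecD ?IH //; apply: laurent_sum.
Qed.

End Specialisation.

Lemma qbin0 (x : int) : qbin x 0 = 1.
Proof. exact (bbin0 qint x). Qed.

Lemma qbin_zero (n : nat) : qbin 0 n.+1%:Z = 0.
Proof.
apply: (mulfI (@qint_neq0 n.+1 isT)).
rewrite mulr0 [LHS](bbin_mul_top qint_neq0 0 n).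
by rewrite (br0 qint_exchange qint_neq0) mul0r.
Qed.

(** Pascal's rule has Laurent coefficients and can be solved for either of the
    binomials of order n + 1, so integrality spreads from x = 0 in both
    directions. *)
Lemma laurent_qbin (x : int) (n : nat) : laurent (qbin x n%:Z).
Proof.
elim: n x => [|n IH] x; first by rewrite qbin0; exact: laurent1.
elim/int_rect: x => [|m IHm|m IHm]; first by rewrite qbin_zero; exact: laurent0.
- rewrite qbin_pascal (_ : m.+1%:Z - 1 = m%:Z); last by lia.
  by apply: laurentD; apply: laurentM; rewrite ?IH //; exact: laurent_qvz.
have e := qbin_pascal (- m%:Z) n.
rewrite (_ : - m%:Z - 1 = - m.+1%:Z) in e; last by lia.
have -> : qbin (- m.+1%:Z) n.+1 =
    qv ^ (- n.+1%:Z) * (qbin (- m%:Z) n.+1%:Z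
    + (-1) * (qv ^ (n.+1%:Z - - m%:Z) * qbin (- m.+1%:Z) n%:Z)).
  by rewrite e mulN1r addrK -invr_expz mulKf //; exact: qvz_neq0.
apply: laurentM; first exact: laurent_qvz.
apply: laurentD => //; apply: laurentM; last first.
  by apply: laurentM => //; exact: laurent_qvz.
by exists (-1), 0%N; rewrite tofracN tofrac1 divr1.
Qed.

Lemma bmul_qbin (m n : nat) : bmul qint m%:Z n%:Z = qbin (m%:Z + n%:Z) m%:Z.
Proof. exact (bmul_bin qint_neq0 m n). Qed.

Lemma laurent_bmul (i j : int) : laurent (bmul qint i j).
Proof.
case: i => m; last exact: laurent0.
case: j => n; last exact: laurent0.
by rewrite bmul_qbin; exact: laurent_qbin.
Qed.

Lemma qbin1 (n : nat) : qbin (1 + n%:Z) 1 = qint n.+1%:Z.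
Proof.
have e := bbin_mul_top qint_neq0 (1 + n%:Z) 0.
rewrite bbin0 mulr1 in e.
rewrite -PoszD add1n in e *; rewrite -e.
have -> : qint 1 = 1; last by rewrite mul1r.
by rewrite /qint expr1z exprN1 divff // qv_sub_neq0.
Qed.

Lemma laurent_qint (n : nat) : laurent (qint n%:Z).
Proof.
case: n => [|n]; last by rewrite -qbin1; exact: laurent_qbin.
by rewrite (br0 qint_exchange qint_neq0); exact: laurent0.
Qed.

Lemma laurent_qfact (n : nat) : laurent (qfact n).
Proof.
elim: n => [|n IH].
  by rewrite (bfact0 qint : qfact 0 = 1); exact: laurent1.
rewrite (bfactS qint n : qfact n.+1 = _); apply: laurentM => //.
exact: laurent_qint.
Qed.

(** * Binomials and structure constants in K *)

Section Constants.

Variables (K : fieldType) (q : K).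
Hypothesis q_neq0 : q != 0.

Definition gbin (x : int) (r : nat) : K := qspec q (qbin x r%:Z).
Definition gmul (i j : int) : K := qspec q (bmul qint i j).

Lemma gbin0 (x : int) : gbin x 0 = 1.
Proof. by rewrite /gbin qbin0 qspec1. Qed.

Lemma gmulC (i j : int) : gmul i j = gmul j i.
Proof. by rewrite /gmul bmulC. Qed.

Lemma gmul0 (n : nat) : gmul 0 n%:Z = 1.
Proof. by rewrite /gmul (bmul0 qint_neq0) qspec1. Qed.

Lemma gmul_neg (i j : int) : i < 0 -> gmul i j = 0.
Proof. by case: i => // i _; rewrite /gmul /= qspec0. Qed.

Lemma gmul_bin (m n : nat) : gmul m%:Z n%:Z = qspec q (qbin (m%:Z + n%:Z) m%:Z).
Proof. by rewrite /gmul bmul_qbin. Qed.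

Lemma qspec_qfactS (n : nat) :
  qspec q (qfact n.+1) = qspec q (qfact n) * gmul 1 n%:Z.
Proof.
rewrite gmul_bin qbin1 -qspecM //; last exact: laurent_qint.
  by rewrite (bfactS qint n : qfact n.+1 = _).
exact: laurent_qfact.
Qed.

Lemma gbin_saalschutz (m n t : nat) (x : int) : (t <= m + n)%N ->
  \sum_(0 <= r < t.+1)
    gbin x r * gbin (x + m%:Z + n%:Z - r%:Z) (t - r)
      * gmul (m%:Z - r%:Z) (n%:Z - (t - r)%N%:Z)
  = gbin (x + n%:Z) t * gmul m%:Z n%:Z.
Proof.
move=> ht; have e := bbin_saalschutz qint_exchange qint_neq0 x ht.
have b0 := laurent_qbin (x + n%:Z) t.
rewrite /gbin /gmul -qspecM //; last exact: laurent_bmul.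
rewrite -[X in _ = qspec q X]e qspec_sum //.
  apply: eq_bigr => r _.
  have b1 := laurent_qbin x r.
  have b2 := laurent_qbin (x + m%:Z + n%:Z - r%:Z) (t - r).
  by rewrite -!qspecM //; first [exact: laurentM | exact: laurent_bmul].
move=> r; apply: laurentM; last exact: laurent_bmul.
by apply: laurentM; exact: laurent_qbin.
Qed.

End Constants.

(** * Weights *)

Section Weights.

Variables (F : archiRealFieldType) (V : vectType F).
Variables (R : root_system V) (Pi : root_basis R).
Implicit Types (a b : simple Pi) (la mu : weight R).

Lemma simple_mem a : wval a \in map val (simples Pi).
Proof. by apply: map_f; exact: ssvalP. Qed.

Lemma pairing_shift mu a (n : int) :
  pairing (mu + (a : weight R) *~ n) a = pairing mu a + 2 * n.
Proof.
have aR := simples_root (simple_mem a).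
have wmu := allP (wvalP mu) _ aR.
have -> : pairing (mu + (a : weight R) *~ n) a =
    Num.floor ((coroot R (wval a) (wval mu) : F) + 2 *~ n).
  congr Num.floor; rewrite -[wval (_ + _)]/(val (mu + (a : weight R) *~ n)).
  by rewrite !raddfD /= -(coroot_root aR) -(raddfMz (coroot R a)) -(raddfMz val).
by rewrite floorDzr // -mulrzr -(intrM F 2 n) intrKfloor.
Qed.

Lemma sum_nseq a (n : nat) :
  \sum_(b <- nseq n a) (b : weight R) = (a : weight R) *+ n.
Proof. by elim: n => [|n IH]; rewrite ?big_nil //= big_cons IH mulrS. Qed.

(** The height, that is the sum of the coordinates in the basis, separates the
    two weights. *)
Lemma weight_le_shift_false mu a (n : nat) : (0 < n)%N ->
  ~ weight_le Pi (mu + (a : weight R) *+ n) mu.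
Proof.
move=> n0 [s es].
pose X := in_tuple (map val (simples Pi)).
have freeX : free X by exact: basis_free (simples_basis Pi).
pose h (v : V) : F := \sum_i coord X i v.
have hD u v : h (u + v) = h u + h v.
  by rewrite /h -big_split; apply: eq_bigr => i _; rewrite linearD.
have h1 b : h (wval b) = 1.
  have lt_b : (index (wval b) X < size (map val (simples Pi)))%N.
    by rewrite index_mem simple_mem.
  pose i0 := Ordinal lt_b.
  have -> : wval b = X`_i0 by rewrite nth_index ?simple_mem.
  rewrite /h (bigD1 i0) // coord_free // eqxx big1 => [|i]; first exact: addr0.
  by rewrite coord_free // eq_sym => /negPf ->.
have h0 : h 0 = 0 by apply: (addrI (h 0)); rewrite -hD !addr0.
have hs (t : seq (simple Pi)) :
    h (val (\sum_(b <- t) (b : weight R))) = (size t)%:R.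
  elim: t => [|b t IH]; first by rewrite big_nil raddf0.
  by rewrite big_cons raddfD hD IH [h _]h1 /= -addn1 natrD addrC.
have := hs (nseq n a ++ s).
rewrite big_cat -es sum_nseq opprD addNKr /= subrr h0 => /eqP.
by rewrite eq_sym pnatr_eq0 size_cat size_nseq; lia.
Qed.

Lemma weight_le_trans la mu nu :
  weight_le Pi la mu -> weight_le Pi mu nu -> weight_le Pi la nu.
Proof.
move=> [s es] [t et]; exists (s ++ t).
by rewrite big_cat -es -et /= addrC subrKA.
Qed.

Lemma weight_le_shift mu a (n : nat) :
  weight_le Pi mu (mu + (a : weight R) *+ n).
Proof. by exists (nseq n a); rewrite sum_nseq addrAC subrr add0r. Qed.

(** Induction on the number of elements of T above mu: for mu in T this set
    contains mu, and the set for mu + n a does not. *)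
Lemma quasi_bounded_ind (T : set (weight R)) (P : weight R -> Prop) :
  quasi_bounded Pi T ->
  (forall mu, ~ T mu -> P mu) ->
  (forall mu,
     (forall a (n : nat), (0 < n)%N -> P (mu + (a : weight R) *+ n)) -> P mu) ->
  forall mu, P mu.
Proof.
move=> qbT Pout Pstep mu.
pose S nu := [set la | T la /\ weight_le Pi nu la]%classic.
have [N] := ubnP #|` fset_set (S mu)|.
elim: N mu => // N IH mu; rewrite ltnS => hN.
have [Tmu|] := pselect (T mu); last exact: Pout.
apply: Pstep => a n n0; apply: IH; apply: leq_trans hN.
have fS nu : finite_set (S nu) by exact: qbT.
apply: fproper_ltn_card; rewrite fproperEneq; apply/andP; split; last first.
  rewrite -fset_set_sub // => la [Tla le_la]; split => //.
  by apply: weight_le_trans le_la; exact: weight_le_shift.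
apply/eqP => /fset_set_inj e.
have : S mu mu by split => //; exists [::]; rewrite subrr big_nil.
by rewrite -e // => -[_]; exact: weight_le_shift_false.
Qed.

End Weights.

Lemma sum_triangle (U : nmodType) (N : nat) (f : nat -> nat -> U) :
  \sum_(0 <= r < N) \sum_(0 <= s < N - r) f r s =
  \sum_(0 <= t < N) \sum_(0 <= r < t.+1) f r (t - r)%N.
Proof.
elim: N => [|N IH]; first by rewrite !big_geq.
rewrite [RHS]big_nat_recr //= -IH [in RHS]big_nat_recr //= subnn addrA -big_split.
rewrite [LHS]big_nat_recr //= subSnn big_nat1; congr (_ + _).
apply: eq_big_nat => r /andP[_ hr].
by rewrite subSn 1?ltnW // big_nat_recr.
Qed.

(** * Commutation of E- and F-operators *)

Section Operators.

Variables (F : archiRealFieldType) (V : vectType F).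
Variables (R : root_system V) (Pi : root_basis R).
Variables (K : fieldType) (q : K) (q_neq0 : q != 0) (M : objX q Pi).
Implicit Types (a b : simple Pi) (la mu : weight R) (v w : M).

Lemma homog0 la : homog la (0 : M).
Proof. by case: (@homog_subspace _ _ _ _ _ M la). Qed.

Lemma homogD la v w : homog la v -> homog la w -> homog la (v + w).
Proof.
by case: (@homog_subspace _ _ _ _ _ M la) => _ h hv hw; rewrite -[v]scale1r; exact: h.
Qed.

Lemma homogZ la (c : K) v : homog la v -> homog la (c *: v).
Proof.
case: (@homog_subspace _ _ _ _ _ M la) => h0 h hv.
by rewrite -[c *: v]addr0; exact: h.
Qed.

Lemma homogE la a (n : int) v :
  homog la v -> homog (la + (a : weight R) *~ n) (opE a n v).
Proof.
case: n => [[|n]|n] hv.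
- by rewrite mulr0z addr0 opE0.
- exact: opE_homog.
- by rewrite opE_neg //; exact: homog0.
Qed.

Lemma homogF la a (n : int) v :
  homog la v -> homog (la - (a : weight R) *~ n) (opF a n v).
Proof.
case: n => [[|n]|n] hv.
- by rewrite mulr0z subr0 opF0.
- by apply: opF_homog => //; rewrite subrK.
- by rewrite opF_neg //; exact: homog0.
Qed.

Lemma EF_neq la a b (m n : nat) v : a != b -> (0 < m)%N -> (0 < n)%N ->
  homog la v -> opE a m%:Z (opF b n%:Z v) = opF b n%:Z (opE a m%:Z v).
Proof.
move=> ab m0 n0 hv.
have hv' : homog (la - (b : weight R) *+ n + (b : weight R) *+ n) v.
  by rewrite subrK.
by have [h _] := objX2 a m0 n0 hv'; exact: h.
Qed.

(** The commutation formula for operators of arbitrary integral degree, in terms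
    of the weight la of v instead of the weight of F_n v.  The sum may be
    cut anywhere beyond one of the two degrees; this lets nested uses of the
    formula share one triangle of indices. *)
Lemma EF_eq la a (m n : int) (N : nat) v :
  (m < N%:Z) || (n < N%:Z) -> homog la v ->
  opE a m (opF a n v) =
    \sum_(0 <= r < N) gbin q (pairing la a + m - n) r *:
      opF a (n - r%:Z) (opE a (m - r%:Z) v).
Proof.
move=> hN hv.
case: m hN => [m|m] hN; last first.
  rewrite opE_neg // big1 // => r _.
  by rewrite [opE _ _ _]opE_neg ?linear0 ?scaler0 //; lia.
case: n hN => [n|n] hN; last first.
  rewrite opF_neg // linear0 big1 // => r _.
  by rewrite opF_neg ?scaler0 //; lia.
have N0 : (minn m n < N)%N by lia.
rewrite (big_cat_nat _ N0) //= [X in _ + X]big_nat [X in _ + X]big1 ?addr0; last first.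
  move=> r hr; have [hm|hn] : (m < r)%N \/ (n < r)%N by lia.
    by rewrite [opE _ _ _]opE_neg ?linear0 ?scaler0 //; lia.
  by rewrite opF_neg ?scaler0 //; lia.
case: m {hN N0} => [|m].
  by rewrite min0n big_nat1 !subr0 !opE0 gbin0 // scale1r.
case: n => [|n].
  by rewrite minn0 big_nat1 !subr0 !opF0 gbin0 // scale1r.
have hv' : homog (la - (a : weight R) *+ n.+1 + (a : weight R) *+ n.+1) v.
  by rewrite subrK.
have [_ /(_ erefl) ->] := objX2 a (ltn0Sn m) (ltn0Sn n) hv'.
have -> : pairing (la - (a : weight R) *+ n.+1) a + m.+1%:Z + n.+1%:Z =
    pairing la a + m.+1%:Z - n.+1%:Z.
  by have := pairing_shift la a (- n.+1%:Z); rewrite mulrNz /= => ->; lia.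
by [].
Qed.

End Operators.

(** * Divided power relations *)

Section DividedPowers.

Variables (F : archiRealFieldType) (V : vectType F).
Variables (R : root_system V) (Pi : root_basis R).
Variables (K : fieldType) (q : K) (q_neq0 : q != 0) (M : objX q Pi).
Implicit Types (a b : simple Pi) (la mu : weight R).

(** The Saalschuetz sum in the form in which both commutation arguments use it:
    f t is F_(m+n-t) E_(k-t) v in one case and F_(l-t) E_(m+n-t) v in the
    other. *)
Lemma collect_products (U : lmodType K) (m n N : nat) (x : int) (f : nat -> U) :
  (forall t, (m + n < t)%N -> f t = 0) ->
  \sum_(0 <= t < N) \sum_(0 <= r < t.+1)
     (gbin q x r * gbin q (x + m%:Z + n%:Z - r%:Z) (t - r)) *:
     (gmul q (m%:Z - r%:Z) (n%:Z - (t - r)%N%:Z) *: f t) =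
  gmul q m%:Z n%:Z *: \sum_(0 <= t < N) gbin q (x + n%:Z) t *: f t.
Proof.
move=> f0; rewrite scaler_sumr; apply: eq_bigr => t _.
under eq_bigr => r _ do rewrite scalerA.
rewrite -scaler_suml; case: (leqP t (m + n)) => ht.
  by rewrite gbin_saalschutz // scalerA mulrC.
by rewrite f0 // !scaler0.
Qed.

(** The operator E_k respects the relation for F_m F_n v, once the relation
    holds for the terms that appear when E_k is moved to the right. *)
Lemma E_FF la a (m n k N : nat) (v : M) : (k < N)%N -> homog la v ->
  (forall t r, (r <= t <= k)%N ->
    opF a (m%:Z - r%:Z) (opF a (n%:Z - (t - r)%N%:Z) (opE a (k%:Z - t%:Z) v)) =
    gmul q (m%:Z - r%:Z) (n%:Z - (t - r)%N%:Z) *: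
      opF a (m%:Z + n%:Z - t%:Z) (opE a (k%:Z - t%:Z) v)) ->
  opE a k%:Z (opF a m%:Z (opF a n%:Z v)) =
  gmul q m%:Z n%:Z *: opE a k%:Z (opF a (m%:Z + n%:Z) v).
Proof.
move=> kN hv hFF.
rewrite (EF_eq (N := N) q_neq0 a _ (homogF a n%:Z hv)); last by rewrite ltz_nat kN.
rewrite [in RHS](EF_eq (N := N) q_neq0 a _ hv); last by rewrite ltz_nat kN.
(* F_n v has weight la - n a, whence the shift by 2 n. *)
pose x := pairing la a + k%:Z - m%:Z - 2 * n%:Z.
have px : pairing (la - (a : weight R) *~ n%:Z) a + k%:Z - m%:Z = x.
  by rewrite -mulrNz pairing_shift /x; lia.
have -> : pairing la a + k%:Z - (m%:Z + n%:Z) = x + n%:Z by rewrite /x; lia.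
rewrite px -(collect_products (m := m)); last first.
  by move=> t ht; rewrite opF_neg //; lia.
pose f r s : M := (gbin q x r * gbin q (x + m%:Z + n%:Z - r%:Z) s) *:
  opF a (m%:Z - r%:Z) (opF a (n%:Z - s%:Z) (opE a (k%:Z - (r + s)%N%:Z) v)).
transitivity (\sum_(0 <= r < N) \sum_(0 <= s < N - r) f r s).
  apply: eq_big_nat => r /andP[_ hr].
  rewrite (EF_eq (N := N - r) q_neq0 a _ hv); last by lia.
  rewrite linear_sum scaler_sumr; apply: eq_bigr => s _.
  rewrite linearZ scalerA /f.
  have -> : pairing la a + (k%:Z - r%:Z) - n%:Z = x + m%:Z + n%:Z - r%:Z.
    by rewrite /x; lia.
  by have -> : k%:Z - r%:Z - s%:Z = k%:Z - (r + s)%N%:Z by lia.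
rewrite sum_triangle; apply: eq_big_nat => t /andP[_ ht].
apply: eq_big_nat => r /andP[_ hr]; rewrite /f subnKC //.
have [htk|htk] := leqP t k; first by rewrite hFF // -ltnS hr.
by rewrite opE_neg ?linear0 ?scaler0 //; lia.
Qed.

(** The relation for E_m E_n passes from w to F_l w.  Here n takes the first
    place in the Saalschuetz sum, because E_n meets F_l first. *)
Lemma EE_F la a (m n l N : nat) (v : M) : (l < N)%N -> homog la v ->
  (forall i j : int, opE a i (opE a j v) = gmul q i j *: opE a (i + j) v) ->
  opE a m%:Z (opE a n%:Z (opF a l%:Z v)) =
  gmul q m%:Z n%:Z *: opE a (m%:Z + n%:Z) (opF a l%:Z v).
Proof.
move=> lN hv hEE.
rewrite (EF_eq (N := N) q_neq0 a _ hv); last by rewrite !ltz_nat lN orbT.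
rewrite [in RHS](EF_eq (N := N) q_neq0 a _ hv); last by rewrite !ltz_nat lN orbT.
pose x := pairing la a + n%:Z - l%:Z.
rewrite -/x gmulC.
have -> : pairing la a + (m%:Z + n%:Z) - l%:Z = x + m%:Z by rewrite /x; lia.
pose g t : M := opF a (l%:Z - t%:Z) (opE a (m%:Z + n%:Z - t%:Z) v).
rewrite -(@collect_products _ n m N x g); last first.
  by move=> t ht; rewrite /g [opE _ _ _]opE_neg ?linear0 //; lia.
pose f r s : M := (gbin q x r * gbin q (x + n%:Z + m%:Z - r%:Z) s) *:
  opF a (l%:Z - (r + s)%N%:Z) (opE a (m%:Z - s%:Z) (opE a (n%:Z - r%:Z) v)).
transitivity (\sum_(0 <= r < N) \sum_(0 <= s < N - r) f r s).
  rewrite linear_sum; apply: eq_big_nat => r /andP[_ hr].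
  rewrite linearZ /=.
  rewrite (EF_eq (N := N - r) q_neq0 a _ (homogE a _ hv)); last by lia.
  rewrite scaler_sumr; apply: eq_bigr => s _.
  rewrite scalerA /f pairing_shift.
  have -> : pairing la a + 2 * (n%:Z - r%:Z) + m%:Z - (l%:Z - r%:Z)
      = x + n%:Z + m%:Z - r%:Z by rewrite /x; lia.
  by have -> : l%:Z - r%:Z - s%:Z = l%:Z - (r + s)%N%:Z by lia.
rewrite sum_triangle; apply: eq_big_nat => t /andP[_ ht].
apply: eq_big_nat => r /andP[_ hr]; rewrite /f subnKC // hEE gmulC.
rewrite linearZ /g.
by have -> : m%:Z - (t - r)%N%:Z + (n%:Z - r%:Z) = m%:Z + n%:Z - t%:Z by lia.
Qed.

Definition weights_of : set (weight R) :=
  [set mu | exists v : M, homog mu v /\ v <> 0]%classic.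

Lemma weights_of_quasi_bounded : quasi_bounded Pi weights_of.
Proof. by case: (objX1 M). Qed.

Lemma homog_outside mu (v : M) : ~ weights_of mu -> homog mu v -> v = 0.
Proof. by move=> h hv; apply: contrapT => v0; apply: h; exists v. Qed.

Lemma imF_sub a mu (l l' : nat) (u u' : M) : (0 < l < l')%N ->
  homog (mu + (a : weight R) *+ l) u -> homog (mu + (a : weight R) *+ l') u' ->
  imF mu (opF a l%:Z u - opF a l'%:Z u').
Proof.
move=> /andP[l0 ll'] hu hu'; exists l'.+1.
exists (fun b n => if b == a then
  (if n == l then u else 0) - (if n == l' then u' else 0) else 0); split.
  move=> b n; case: eqP => [->|_]; last exact: homog0.
  apply: homogD; first by case: eqP => [->|_] //; exact: homog0.
  rewrite -scaleN1r; apply: homogZ.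
  by case: eqP => [->|_] //; exact: homog0.
rewrite (bigD1 a) //= eqxx [X in _ = _ + X]big1 ?addr0; last first.
  by move=> b /negPf hb; rewrite big1 // => n _; rewrite hb linear0.
under eq_bigr => n _ do rewrite linearB /=.
rewrite big_split /= sumrN; congr (_ - _).
  rewrite (bigD1_seq l) ?iota_uniq ?mem_index_iota //=; last by lia.
  by rewrite eqxx big1 ?addr0 // => n /negPf ->; rewrite linear0.
rewrite (bigD1_seq l') ?iota_uniq ?mem_index_iota //=; last by lia.
by rewrite eqxx big1 ?addr0 // => n /negPf ->; rewrite linear0.
Qed.

(** The difference of the two sides lies in the image of F.  It is killed by
    E_(b,k) because of [EF_neq] if b is not a, and because of [E_FF] and the
    two inductions if b = a; hence it is 0 by (X3). *)
Lemma FF_homog a la (v : M) (i j : int) : homog la v ->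
  opF a i (opF a j v) = gmul q i j *: opF a (i + j) v.
Proof.
move: la v i j; apply: (quasi_bounded_ind weights_of_quasi_bounded) =>
  [mu out v i j hv|la IH v i j hv].
  by rewrite (homog_outside out hv) !linear0 ?scaler0.
case: i => [m|m]; last by rewrite opF_neg // gmul_neg ?scale0r.
case: j => [n|n]; last first.
  by rewrite (opF_neg a (n := Negz n)) // linear0 gmulC gmul_neg ?scale0r.
have [N] := ubnP (m + n); elim: N m n => // N IHN m n; rewrite ltnS => hN.
have IHint (i j : int) : i + j < (m + n)%N%:Z ->
    opF a i (opF a j v) = gmul q i j *: opF a (i + j) v.
  case: i => [m'|m']; last by rewrite opF_neg // gmul_neg ?scale0r.
  case: j => [n'|n'] h; last first.
    by rewrite (opF_neg a (n := Negz n')) // linear0 gmulC gmul_neg ?scale0r.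
  by apply: IHN; lia.
case: m hN IHint => [|m] hN IHint; first by rewrite opF0 gmul0 // scale1r add0r.
case: n hN IHint => [|n] hN IHint.
  by rewrite opF0 gmulC gmul0 // scale1r addr0.
set c := gmul q _ _.
pose z := opF a m.+1%:Z (opF a n.+1%:Z v) - c *: opF a (m.+1%:Z + n.+1%:Z) v.
suff z0 : z = 0 by apply/eqP; rewrite -subr_eq0 -/z z0.
have [_] := objX3 M (la - (a : weight R) *~ (m.+1%:Z + n.+1%:Z)).
apply.
- have hz : homog (la - (a : weight R) *~ (m.+1%:Z + n.+1%:Z)) z.
    apply: homogD; last by rewrite -scaleNr; apply: homogZ; exact: homogF.
    rewrite mulrzDr opprD addrA addrAC; apply: homogF; exact: homogF.
  split => // b k k0; rewrite linearB linearZ /=.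
  apply/eqP; rewrite subr_eq0; apply/eqP.
  have hEv := opE_homog b k0 hv.
  have [eab|ab] := eqVneq a b.
    rewrite -eab in hEv *.
    apply: (E_FF (ltnSn k) hv) => t r /andP[rt tk].
    have e : m.+1%:Z - r%:Z + (n.+1%:Z - (t - r)%N%:Z)
      = m.+1%:Z + n.+1%:Z - t%:Z by lia.
    (* For t < k the vector E_(k-t) v has higher weight; for t = k the degree
       m + n - t is smaller. *)
    have [tlt|tge] := ltnP t k.
      rewrite (IH a (k - t)%N) ?subn_gt0 ?e //.
      by rewrite pmulrn -subzn ?(ltnW tlt) //; exact: homogE.
    rewrite (_ : k%:Z - t%:Z = 0) ?opE0; last by lia.
    by rewrite IHint e //; lia.
  rewrite eq_sym in ab; rewrite -PoszD.
  rewrite (EF_neq ab k0 _ (homogF a _ hv)) // !(EF_neq ab k0 _ hv) //.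
  by rewrite (IH b k k0).
- rewrite /z -PoszD -linearZ; apply: imF_sub; first by lia.
    have := homogF a n.+1%:Z hv.
    by rewrite PoszD mulrzDr opprD addrA addrAC subrK.
  by rewrite subrK; exact: homogZ.
Qed.

(** On the kernel part of v in (X3) both sides vanish, and the image part is
    covered by [EE_F] and the induction. *)
Lemma EE_homog a la (v : M) (i j : int) : homog la v ->
  opE a i (opE a j v) = gmul q i j *: opE a (i + j) v.
Proof.
move: la v i j; apply: (quasi_bounded_ind weights_of_quasi_bounded) =>
  [mu out v i j hv|la IH v i j hv].
  by rewrite (homog_outside out hv) !linear0 ?scaler0.
case: i => [m|m]; last by rewrite opE_neg // gmul_neg ?scale0r.
case: j => [n|n]; last first.
  by rewrite (opE_neg a (n := Negz n)) // linear0 gmulC gmul_neg ?scale0r.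
case: m => [|m]; first by rewrite opE0 gmul0 // scale1r add0r.
case: n => [|n]; first by rewrite opE0 gmulC gmul0 // scale1r addr0.
have [/(_ v hv)[k [f [[_ kerk] [N [w [hw ->]]] ->]]] _] := objX3 M la.
rewrite !linearD -PoszD !kerk // !linear0 !add0r !linear_sum /=.
apply: eq_bigr => b _; rewrite !linear_sum /= big_nat [RHS]big_nat.
apply: eq_bigr => l /andP[l0 _].
have hwl := hw b l.
have [eab|ab] := eqVneq a b.
  rewrite -eab PoszD in hwl *; apply: (EE_F _ _ (ltnSn l) hwl).
  by move=> i j; exact: (IH a l l0).
rewrite !(EF_neq ab _ _ hwl) // (EF_neq ab _ _ (homogE a _ hwl)) //.
by rewrite (IH b l l0 _ _ _ hwl) linearZ.
Qed.

Lemma homog_linear_ind (P : M -> Prop) :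
  P 0 -> (forall v w, P v -> P w -> P (v + w)) ->
  (forall la v, homog la v -> P v) -> forall v, P v.
Proof.
move=> P0 PD Ph v; have [/(_ v)[s [c [hc ->]]] _] := @homog_direct _ _ _ _ _ M.
by elim/big_ind: _ => // la _; exact: Ph (hc la).
Qed.

Lemma FF_mul a (v : M) (i j : int) :
  opF a i (opF a j v) = gmul q i j *: opF a (i + j) v.
Proof.
elim/homog_linear_ind: v => [|v w hv hw|la v]; first by rewrite !linear0 ?scaler0.
  by rewrite !linearD hv hw.
exact: FF_homog.
Qed.

Lemma EE_mul a (v : M) (i j : int) :
  opE a i (opE a j v) = gmul q i j *: opE a (i + j) v.
Proof.
elim/homog_linear_ind: v => [|v w hv hw|la v]; first by rewrite !linear0 ?scaler0.
  by rewrite !linearD hv hw.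
exact: EE_homog.
Qed.

End DividedPowers.

Lemma iter_divided_power (K : fieldType) (q : K) (U : lmodType K)
    (X : int -> U -> U) : q != 0 ->
  (forall v, X 0 v = v) ->
  (forall (c : K) i v, X i (c *: v) = c *: X i v) ->
  (forall i j v, X i (X j v) = gmul q i j *: X (i + j) v) ->
  forall (n : nat) v, qspec q (qfact n) *: X n%:Z v = iter n (X 1) v.
Proof.
move=> q0 X0 XZ XX n v; elim: n => [|n IH].
  by rewrite X0 (bfact0 qint : qfact 0 = 1) qspec1 // scale1r.
by rewrite iterS -IH XZ XX scalerA -qspec_qfactS // -PoszD.
Qed.

Theorem lemma5p2 (F : archiRealFieldType) (V : vectType F)
    (R : root_system V) (Pi : root_basis R) (hR : simply_laced Pi)
    (K : fieldType) (q : K) (hq : q != 0)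
    (M : objX q Pi) (a : simple Pi) :
  (forall (m n : nat) (v : M),
     opE a m%:Z (opE a n%:Z v) =
       qspec q (qbin (m%:Z + n%:Z) m%:Z) *: opE a (m%:Z + n%:Z) v /\
     opF a m%:Z (opF a n%:Z v) =
       qspec q (qbin (m%:Z + n%:Z) m%:Z) *: opF a (m%:Z + n%:Z) v) /\
  (forall (m n : nat) (v : M),
     opE a m%:Z (opE a n%:Z v) = opE a n%:Z (opE a m%:Z v) /\
     opF a m%:Z (opF a n%:Z v) = opF a n%:Z (opF a m%:Z v)) /\
  (forall (n : nat) (v : M),
     qspec q (qfact n) *: opE a n%:Z v = iter n (opE a 1) v /\
     qspec q (qfact n) *: opF a n%:Z v = iter n (opF a 1) v).
Proof.
split; [|split] => [m n v|m n v|n v].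
- by rewrite -gmul_bin EE_mul // FF_mul.
- by rewrite !EE_mul // !FF_mul // gmulC [m%:Z + _]addrC.
split.
- apply: (iter_divided_power (X := fun i => opE a i : M -> M) hq) => [w|c i w|i j w].
  + exact: opE0.
  + by rewrite linearZ.
  + exact: EE_mul.
- apply: (iter_divided_power (X := fun i => opF a i : M -> M) hq) => [w|c i w|i j w].
  + exact: opF0.
  + by rewrite linearZ.
  + exact: FF_mul.
Qed.
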